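(* Let $\mathcal{A}$ be a central hyperplane arrangement in $V=\mathbb{K}^\ell$ and $H\in\mathcal{A}$. Suppose that the restriction map $\mathbf{res}_H^1:\Omega^1(\mathcal{A})\to\Omega^1(\mathcal{A}^H,\mathbf{k})$ is surjective and that the restricted multiarrangement $(\mathcal{A}^H,\mathbf{k})$ is free with multiexponents $(d_2',\dots,d_\ell')$. Then $\mathcal{A}$ is free with exponents $(1,d_2',\dots,d_\ell')$.
   Context: $\mathbb{K}$ is a field of characteristic $0$, $V$ an $\ell$-dimensional $\mathbb{K}$-vector space, $S=\mathbb{K}[V^*]$. A central arrangement $\mathcal{A}$ is a finite set of linear hyperplanes of $V$; for each $H\in\mathcal{A}$ fix a linear form $\alpha_H$ with kernel $H$. A multiarrangement is a pair $(\mathcal{A},\mathbf{k})$ with $\mathbf{k}:\mathcal{A}\to\mathbb{Z}_{\ge0}$; put $Q(\mathcal{A},\mathbf{k})=\prod_H\alpha_H^{\mathbf{k}(H)}$ (for an ordinary arrangement $\mathbf{k}\equiv1$ and $Q=\prod_H\alpha_H$). Define $D(\mathcal{A},\mathbf{k})=\{\delta\in\mathrm{Der}_V:\delta(\alpha_H)\in\alpha_H^{\mathbf{k}(H)}S\ \forall H\}$ and $\Omega^p(\mathcal{A},\mathbf{k})=\{\omega\in\frac{1}{Q(\mathcal{A},\mathbf{k})}\Omega^p_V: Q(\mathcal{A},\mathbf{k})\frac{d\alpha_H}{\alpha_H^{\mathbf{k}(H)}}\wedge\omega\in\Omega^{p+1}_V\ \forall H\}$, where $\Omega^p_V$ are polynomial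 $p$-forms; $D(\mathcal{A})$, $\Omega^p(\mathcal{A})$ denote the case $\mathbf{k}\equiv1$. $(\mathcal{A},\mathbf{k})$ is free if $D(\mathcal{A},\mathbf{k})$ is a free $S$-module; the (multi)exponents are then the degrees of a homogeneous basis of $D(\mathcal{A},\mathbf{k})$ (polynomial degree of coefficients). The restriction of $\mathcal{A}$ to $H$ is $\mathcal{A}^H=\{H'\cap H: H'\in\mathcal{A}\setminus\{H\}\}$ (an arrangement in $H$) with multiplicity $\mathbf{k}(X)=\#\{H'\in\mathcal{A}\setminus\{H\}: H'\cap H=X\}$. Choose coordinates $(z_1,\dots,z_\ell)$ with $H=\{z_1=0\}$; every $\omega\in\Omega^p(\mathcal{A})$ is uniquely $\omega=\omega_1+\frac{dz_1}{z_1}\wedge\omega_2$ with $\omega_1,\omega_2$ rational forms in $dz_2,\dots,dz_\ell$, and $\omega_1|_H\in\Omega^p(\mathcal{A}^H,\mathbf{k})$. The restriction map is $\mathbf{res}_H^p(\omega)=\omega_1|_H$. *)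

(* Defs.v *)
From HB Require Import structures.
From mathcomp Require Import all_boot all_order all_algebra.
From mathcomp Require Export mpoly.
Set Implicit Arguments. Unset Strict Implicit. Unset Printing Implicit Defensive.
Import Order.TTheory GRing.Theory.
Local Open Scope ring_scope.

Section Arr.
Variable K : fieldType.

Notation S m := {mpoly K[m]}.

Definition lin m (a : 'rV[K]_m) : S m := \sum_(i < m) a 0 i *: 'X_i.

Definition mdvd m (p q : S m) : Prop := exists r : S m, q = p * r.

(* Two nonzero linear forms define the same hyperplane iff proportional,
   i.e. they have the same row space. *)
Definition propf m (a b : 'rV[K]_m) : bool := (a <= b)%MS && (b <= a)%MS.

(* A central arrangement, given by a defining form alpha_H for each
   hyperplane H: nonzero forms, pairwise defining distinct hyperplanes. *)
Definition is_arrangement m (A : seq 'rV[K]_m) : Prop :=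
  uniq A /\ (forall a, a \in A -> a != 0) /\
  (forall a b, a \in A -> b \in A -> a != b -> ~~ propf a b).

(* A multiarrangement: list of (alpha_X, k(X)) with distinct hyperplanes. *)
Definition multiarr m := seq ('rV[K]_m * nat).

Definition simple m (A : seq 'rV[K]_m) : multiarr m := [seq (a, 1%N) | a <- A].

Definition Qm m (M : multiarr m) : S m := \prod_(x <- M) lin x.1 ^+ x.2.

(* A polynomial vector field (derivation) theta = sum_j theta_j d/dx_j. *)
Definition der m := 'I_m -> S m.
Definition der_app m (th : der m) (a : 'rV[K]_m) : S m :=
  \sum_(j < m) (a 0 j)%:MP * th j.

Definition inD m (M : multiarr m) (th : der m) : Prop :=
  forall x, x \in M -> mdvd (lin x.1 ^+ x.2) (der_app th x.1).

Definition free_with_exponents m (M : multiarr m) (d : 'I_m -> nat) : Prop :=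
  exists th : 'I_m -> der m,
    (forall i, inD M (th i)) /\
    (forall i j, th i j \is (d i).-homog) /\
    (forall de : der m, inD M de ->
       exists f : 'I_m -> S m, forall j, de j = \sum_(i < m) f i * th i j) /\
    (forall f : 'I_m -> S m, (forall j, \sum_(i < m) f i * th i j = 0) ->
       forall i, f i = 0).

(* Rational 1-forms omega in (1/Q(A,k)) Omega^1_V are represented by their
   numerator p : omega = (1/Q(A,k)) sum_i p_i dx_i.  Then
   Q (d alpha / alpha^k) /\ omega = alpha^-k sum_(i,j) a_i p_j dx_i/\dx_j,
   which is polynomial iff alpha^k divides every a_i p_j - a_j p_i. *)
Definition inOmega1 m (M : multiarr m) (p : 'I_m -> S m) : Prop :=
  forall x, x \in M -> forall i j : 'I_m,
    mdvd (lin x.1 ^+ x.2) ((x.1 0 i)%:MP * p j - (x.1 0 j)%:MP * p i).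

(* ---- Restriction to H = {x_0 = 0}, identified with K^n via the
   coordinates (x_1, ..., x_n). ---- *)

Definition restrH n (p : S n.+1) : S n :=
  p \mPo [tuple (if unlift ord0 i is Some j then 'X_j else 0 : S n) | i < n.+1].

Definition restr_form n (a : 'rV[K]_n.+1) : 'rV[K]_n := \row_i a 0 (lift ord0 i).

Fixpoint classes m (s : seq 'rV[K]_m) : seq 'rV[K]_m :=
  match s with
  | [::] => [::]
  | b :: s' => let r := classes s' in if has (propf b) r then r else b :: r
  end.

(* The restricted multiarrangement (A^H, k) (Ziegler multirestriction):
   X = H' /\ H, k(X) = #{H' in A \ {H} : H' /\ H = X}. *)
Definition restr_multi n (A : seq 'rV[K]_n.+1) (aH : 'rV[K]_n.+1) : multiarr n :=
  let R := [seq restr_form a | a <- A & a != aH] in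
  [seq (b, count (propf b) R) | b <- classes R].

(* "the restriction of the rational function p/Q to H equals r/QH":
   p/Q = u/v with v not identically zero on H and u|_H / v|_H = r/QH. *)
Definition restr_rat_eq n (p Q : S n.+1) (r QH : S n) : Prop :=
  exists u v : S n.+1, restrH v != 0 /\ p * v = Q * u /\
    restrH u * QH = r * restrH v.

(* res^1_H(omega) = eta, for omega = (1/Q(A)) sum_i p_i dx_i and
   eta = (1/Q(A^H,k)) sum_i r_i dy_i :  omega_1|_H = eta, where
   omega_1 = sum_(i >= 1) (p_i/Q(A)) dx_i. *)
Definition res1_eq n (A : seq 'rV[K]_n.+1) (aH : 'rV[K]_n.+1)
    (p : 'I_n.+1 -> S n.+1) (r : 'I_n -> S n) : Prop :=
  forall i : 'I_n,
    restr_rat_eq (p (lift ord0 i)) (Qm (simple A)) (r i) (Qm (restr_multi A aH)).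

Definition res1_surjective n (A : seq 'rV[K]_n.+1) (aH : 'rV[K]_n.+1) : Prop :=
  forall r : 'I_n -> S n, inOmega1 (restr_multi A aH) r ->
    exists p : 'I_n.+1 -> S n.+1, inOmega1 (simple A) p /\ res1_eq A aH p r.

Definition cons_exp n (d : 'I_n -> nat) : 'I_n.+1 -> nat :=
  fun i => if unlift ord0 i is Some j then d j else 1%N.

End Arr.

(* Main.v *)
Require Import Defs.
From HB Require Import structures.
From mathcomp Require Import all_boot all_order all_algebra.
From mathcomp Require Import mpoly ring zify.
Set Implicit Arguments. Unset Strict Implicit. Unset Printing Implicit Defensive.
Import GRing.Theory.
Local Open Scope ring_scope.

(** The argument is Saito's criterion on both sides of the duality between
    derivations and logarithmic 1-forms.  A homogeneous basis of D(A^H, k) has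
    determinant a nonzero constant times Q(A^H, k), hence |k| = d'_2 + ... + d'_l,
    and its adjugate provides numerators of forms eta_i of degree -d'_i in
    Omega^1(A^H, k).  Surjectivity lifts them to homogeneous forms omega_i of the
    same degrees in Omega^1(A); add omega_1 = d x_0 / x_0.  The determinant of
    (omega_1, ..., omega_l) is q / Q(A) for a polynomial q, which is constant by
    degree count and nonzero because its restriction to H is essentially the
    determinant of the eta_i.  The inverse matrix then has polynomial entries and
    its columns form a basis of D(A).  Unique factorization in S is only needed
    for products of linear forms, where it reduces to their primality. *)

(** * Divisibility by linear forms and their primality *)

Section LinearForms.
Variables (K : fieldType) (m : nat).
Implicit Types (p q r : {mpoly K[m]}) (a b : 'rV[K]_m).

Lemma mdvd_mull p q r : mdvd p q -> mdvd p (r * q).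
Proof. by case=> s ->; exists (r * s); rewrite mulrCA. Qed.

Lemma mdvd_mulr p q r : mdvd p q -> mdvd p (q * r).
Proof. by rewrite mulrC; apply: mdvd_mull. Qed.

Lemma mdvdD p q r : mdvd p q -> mdvd p r -> mdvd p (q + r).
Proof. by move=> [s ->] [t ->]; exists (s + t); rewrite mulrDr. Qed.

Lemma mdvdN p q : mdvd p q -> mdvd p (- q).
Proof. by move=> [s ->]; exists (- s); rewrite mulrN. Qed.

Lemma mdvd0 p : mdvd p 0.
Proof. by exists 0; rewrite mulr0. Qed.

Lemma mdvd_refl p : mdvd p p.
Proof. by exists 1; rewrite mulr1. Qed.

Lemma mdvd_trans p q r : mdvd p q -> mdvd q r -> mdvd p r.
Proof. by move=> [s ->] [t ->]; exists (s * t); rewrite mulrA. Qed.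

Lemma mdvd_sum (I : Type) (l : seq I) (P : pred I) (F : I -> {mpoly K[m]}) p :
  (forall i, P i -> mdvd p (F i)) -> mdvd p (\sum_(i <- l | P i) F i).
Proof. by move=> pF; elim/big_ind: _ => //; [exact: mdvd0|exact: mdvdD]. Qed.

Lemma mdvd_mul2l p q r : p != 0 -> mdvd (p * q) (p * r) -> mdvd q r.
Proof. by move=> p0 [s /esym]; rewrite -mulrA => /(mulfI p0) <-; exists s. Qed.

Lemma meval_lin (v : 'I_m -> K) a : (lin a).@[v] = \sum_i a 0 i * v i.
Proof.
by rewrite raddf_sum; apply: eq_bigr => i _ /=; rewrite mevalZ mevalXU.
Qed.

Lemma linZ (c : K) a : lin (c *: a) = c *: lin a.
Proof. by rewrite scaler_sumr; apply: eq_bigr => i _; rewrite mxE scalerA. Qed.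

Lemma lin_neq0 a : a != 0 -> lin a != 0.
Proof.
case/rV0Pn => k ak; apply: contraNneq ak => l0.
have := meval_lin (fun j => (j == k)%:R) a; rewrite l0 meval0 (bigD1 k) //=.
rewrite eqxx mulr1 big1 ?addr0 => [<- //|i /negPf ->]; exact: mulr0.
Qed.

Lemma lin_homog a : lin a \is 1.-homog.
Proof.
by apply: rpred_sum => i _; apply: rpredZ; rewrite dhomogX /= mdeg1.
Qed.

Lemma propfP a b : a != 0 -> reflect (exists2 c : K, c != 0 & b = c *: a) (propf a b).
Proof.
move=> a0; apply: (iffP andP) => [[/sub_rVP[c ac] /sub_rVP[e be]]|[c c0 ->]].
  exists e => //; apply: contra_neq a0 => e0.
  by rewrite ac be e0 scale0r scaler0.
split; last exact: scalemx_sub.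
by rewrite -{1}[a]scale1r -(mulVf c0) -scalerA scalemx_sub.
Qed.

Lemma propf_refl a : propf a a.
Proof. by rewrite /propf submx_refl. Qed.

Lemma propf_sym a b : propf a b = propf b a.
Proof. by rewrite /propf andbC. Qed.

Lemma propf_trans b a c : propf a b -> propf b c -> propf a c.
Proof.
move=> /andP[ab ba] /andP[bc cb].
by rewrite /propf (submx_trans ab bc) (submx_trans cb ba).
Qed.

Lemma lin_dvd_lin a b : a != 0 -> b != 0 -> mdvd (lin a) (lin b) -> propf a b.
Proof.
move=> a0 b0 [r ab]; case/rV0Pn: (a0) => k ak.
suff E : b = (b 0 k / a 0 k) *: a.
  apply/propfP => //; exists (b 0 k / a 0 k) => //.
  by apply: contra_neq b0 => c0; rewrite E c0 scale0r.
apply/rowP => j; rewrite mxE; case: (eqVneq j k) => [->|jk]; first by rewrite divfK.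
(* The point [v] lies on the hyperplane of [a], so [lin b] vanishes there as well, which gives
   [b 0 j * a 0 k = b 0 k * a 0 j]. *)
pose v i : K := a 0 k *+ (i == j) - a 0 j *+ (i == k).
have ev c : (lin c).@[v] = c 0 j * a 0 k - c 0 k * a 0 j.
  rewrite meval_lin (bigD1 j) //= (bigD1 k) 1?eq_sym //=
    big1 => [|i /andP[/negPf ij /negPf ik]].
    by rewrite /v !eqxx (negPf jk) eq_sym (negPf jk) /= !mulr1n !mulr0n; ring.
  by rewrite /v ij ik subr0 mulr0.
have := ev b; rewrite ab mevalM ev [a 0 j * _]mulrC subrr mul0r => /esym/eqP.
by rewrite subr_eq0 => /eqP E; apply: (mulIf ak); rewrite E mulrAC divfK.
Qed.

(* Substituting for one variable its expression on the hyperplane is an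
   endomorphism with kernel generated by the form, so that the form is prime. *)
Lemma lin_kernel a : a != 0 ->
  exists s : {rmorphism {mpoly K[m]} -> {mpoly K[m]}},
    forall p, mdvd (lin a) p <-> s p = 0.
Proof.
case/rV0Pn => k ak.
pose b : {mpoly K[m]} := 'X_k - (a 0 k)^-1 *: lin a.
pose t := [tuple (if i == k then b else 'X_i) | i < m].
pose s := comp_mpoly t : {rmorphism {mpoly K[m]} -> {mpoly K[m]}}.
have sX i : s 'X_i = if i == k then b else 'X_i.
  by rewrite /s /= comp_mpolyXU -tnth_nth tnth_mktuple.
have bE : b = - \sum_(i < m | i != k) (a 0 i / a 0 k) *: 'X_i.
  rewrite /b /lin (bigD1 k) //= scalerDr scalerA mulVf // scale1r opprD addNKr.
  by rewrite scaler_sumr; congr (- _); apply: eq_bigr => i _; rewrite scalerA mulrC.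
have sl : s (lin a) = 0.
  rewrite /lin (bigD1 k) //= rmorphD rmorph_sum /=.
  rewrite !comp_mpolyZ -[X in _ *: X]/(s 'X_k) sX eqxx bE.
  apply/eqP; rewrite scalerN addrC subr_eq0 scaler_sumr; apply/eqP.
  apply: eq_bigr => i /negPf ik.
  by rewrite comp_mpolyZ -[X in _ *: X]/(s 'X_i) sX ik scalerA mulrC divfK.
have sp p : mdvd (lin a) (p - s p).
  rewrite [p]mpolyE rmorph_sum -sumrB; apply: mdvd_sum => u _.
  rewrite [s _]comp_mpolyZ -scalerBr -mul_mpolyC; apply: mdvd_mull.
  rewrite -[X in _ - X]/(s 'X_[u]) mpolyXE_id rmorph_prod.
  (* On a monomial the difference telescopes over the variables; [s] moves only ['X_k], and
     ['X_k - b] is a multiple of [lin a]. *)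
  elim/big_rec2: _ => [|i y x _ xy]; first by rewrite subrr; apply: mdvd0.
  have -> : 'X_i ^+ u i * y - s ('X_i ^+ u i) * x
          = 'X_i ^+ u i * (y - x) + ('X_i ^+ u i - s ('X_i ^+ u i)) * x by ring.
  apply: mdvdD; first exact: mdvd_mull.
  apply: mdvd_mulr; rewrite rmorphXn subrXX; apply: mdvd_mulr; rewrite /= sX.
  case: eqP => [->|_]; last by rewrite subrr; apply: mdvd0.
  by rewrite /b opprB addrC subrK -mul_mpolyC; apply/mdvd_mull/mdvd_refl.
exists s => p; split=> [[r ->]|s0]; first by rewrite rmorphM [s _]sl mul0r.
by rewrite -[p]subr0 -s0.
Qed.

Lemma lin_prime a p q : a != 0 ->
  mdvd (lin a) (p * q) -> mdvd (lin a) p \/ mdvd (lin a) q.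
Proof.
move=> /lin_kernel[s sP] /sP; rewrite rmorphM => /eqP; rewrite mulf_eq0.
by case/orP => /eqP/sP; [left|right].
Qed.

Lemma lin_ndvd1 a : a != 0 -> ~ mdvd (lin a) 1.
Proof.
by move=> /lin_kernel[s sP] /sP; rewrite rmorph1 => /eqP; rewrite oner_eq0.
Qed.

Lemma lin_prime_exp a p k : a != 0 -> mdvd (lin a) (p ^+ k) -> mdvd (lin a) p.
Proof.
move=> a0; elim: k => [/(lin_ndvd1 a0) //|k IH]; rewrite exprS.
by case/(lin_prime a0).
Qed.

(** Induction on [k]: primality puts one factor [lin a] into [q], which is then cancelled on both
    sides. *)
Lemma lin_exp_gauss a k p q : a != 0 -> ~ mdvd (lin a) p ->
  mdvd (lin a ^+ k) (p * q) -> mdvd (lin a ^+ k) q.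
Proof.
move=> a0 ap; elim: k q => [|k IH] q; first by exists q; rewrite mul1r.
move=> dv; have dv1 : mdvd (lin a) (p * q).
  by apply: mdvd_trans dv; rewrite exprS; apply/mdvd_mulr/mdvd_refl.
have [//|[q' qE]] := lin_prime a0 dv1.
move: dv; rewrite qE exprS mulrCA => /(mdvd_mul2l (lin_neq0 a0))/IH[r ->].
by exists r; rewrite mulrA.
Qed.

Lemma lin_exp_gauss_iter a k l p q : a != 0 -> ~ mdvd (lin a) p ->
  mdvd (lin a ^+ k) (p ^+ l * q) -> mdvd (lin a ^+ k) q.
Proof.
move=> a0 ap; apply: lin_exp_gauss => //; move/(lin_prime_exp a0); exact: ap.
Qed.

End LinearForms.

(** * Defining polynomials of multiarrangements and Saito's determinant *)

Section Multiarrangements.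
Variables (K : fieldType) (m : nat).
Implicit Types (p q r : {mpoly K[m]}) (a b : 'rV[K]_m) (M : multiarr K m).

Lemma is_arrangement_perm (s t : seq 'rV[K]_m) :
  perm_eq s t -> is_arrangement s -> is_arrangement t.
Proof.
move=> st [us [s0 sd]]; split; first by rewrite -(perm_uniq st).
by split=> [a|a b]; rewrite -!(perm_mem st); [apply: s0|apply: sd].
Qed.

Lemma is_arrangement_cons a (s : seq 'rV[K]_m) : is_arrangement (a :: s) ->
  [/\ is_arrangement s, a != 0 & forall b, b \in s -> ~~ propf a b].
Proof.
case=> /= /andP[aNs us] [s0 sd]; split; last 2 first.
- by apply: s0; rewrite mem_head.
- move=> b bs; apply: sd; rewrite ?mem_head // ?inE ?bs ?orbT //.
  by apply: contraNneq aNs => ->.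
split=> //; split=> [b bs|b c bs cs]; first by apply: s0; rewrite inE bs orbT.
by apply: sd; rewrite inE ?bs ?cs orbT.
Qed.

Lemma Qm_cons x M : Qm (x :: M) = lin x.1 ^+ x.2 * Qm M.
Proof. exact: big_cons. Qed.

Lemma lin_dvd_Qm a M : a != 0 -> {in M, forall x, x.1 != 0} ->
  mdvd (lin a) (Qm M) -> exists2 x, x \in M & propf a x.1.
Proof.
move=> a0; elim: M => [|x M IH] M0; first by rewrite /Qm big_nil => /(lin_ndvd1 a0).
rewrite Qm_cons => /(lin_prime a0)[/(lin_prime_exp a0)/lin_dvd_lin ax|].
  by exists x; [rewrite mem_head|apply: ax => //; apply: M0; rewrite mem_head].
case/IH => [y yM|y yM ay]; first by apply: M0; rewrite inE yM orbT.
by exists y; rewrite // inE yM orbT.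
Qed.

Lemma lin_ndvd_Qm x M : is_arrangement (unzip1 (x :: M)) -> ~ mdvd (lin x.1) (Qm M).
Proof.
case/is_arrangement_cons => [[_ [M0 _]] x0 xM] /(lin_dvd_Qm x0)[y yM|y yM].
  by apply: M0; apply: map_f.
by apply/negP/xM/map_f.
Qed.

Lemma Qm_neq0 M : is_arrangement (unzip1 M) -> Qm M != 0.
Proof.
case=> _ [M0 _]; rewrite /Qm prodf_seq_neq0; apply/allP => x xM /=.
by rewrite expf_neq0 // lin_neq0 // M0 // map_f.
Qed.

(** Distinct hyperplanes give pairwise coprime prime powers, so their separate divisibilities
    multiply up. *)
Lemma Qm_dvd M p : is_arrangement (unzip1 M) ->
  {in M, forall x, mdvd (lin x.1 ^+ x.2) p} -> mdvd (Qm M) p.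
Proof.
elim: M => [_ _|x M IH arr dv]; first by exists p; rewrite /Qm big_nil mul1r.
have [arrM x0 _] := is_arrangement_cons arr.
have [y yM|q pE] := IH arrM; first by apply: dv; rewrite inE yM orbT.
have := dv _ (mem_head _ _); rewrite pE Qm_cons.
case/(lin_exp_gauss x0 (lin_ndvd_Qm arr)) => r ->.
by exists r; rewrite mulrCA mulrA.
Qed.

(** The cofactor [p] turns any vector field tangent to [x] to the right order into one in the whole
    module [D]. *)
Lemma Qm_split M x : is_arrangement (unzip1 M) -> x \in M ->
  exists p, [/\ Qm M = lin x.1 ^+ x.2 * p, ~ mdvd (lin x.1) p
    & {in M, forall y, y != x -> mdvd (lin y.1 ^+ y.2) p}].
Proof.
move=> arr xM; have pM := perm_to_rem xM; exists (Qm (rem x M)); split.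
- by rewrite -Qm_cons; apply: perm_big.
- by apply: lin_ndvd_Qm; apply: is_arrangement_perm arr; apply: perm_map.
move=> y; rewrite (perm_mem pM) inE => /orP[->//|/perm_to_rem yM _].
rewrite [Qm _](perm_big _ yM) /= big_cons; exact/mdvd_mulr/mdvd_refl.
Qed.

(** Each prime power in [Qm M] is coprime to [g], so it can be stripped from the multiple of [g]; in
    the end [g] divides 1. *)
Lemma dvd_Qm_const M g : is_arrangement (unzip1 M) ->
  {in M, forall x, ~ mdvd (lin x.1) g} -> mdvd g (Qm M) ->
  exists2 c : K, c != 0 & g = c%:MP.
Proof.
elim: M => [_ _ [h]|x M IH arr gM].
  rewrite /Qm big_nil => gh.
  have g0 : g != 0 by apply: contra_eq_neq gh => ->; rewrite mul0r oner_neq0.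
  have h0 : h != 0 by apply: contra_eq_neq gh => ->; rewrite mulr0 oner_neq0.
  apply/msize_poly1P; have := msizeM g0 h0; rewrite -gh msize1.
  move: g0 h0; rewrite -!msize_poly_eq0 -!lt0n.
  by move: (msize g) (msize h) => u v; lia.
have [arrM x0 _] := is_arrangement_cons arr.
rewrite Qm_cons => -[h E]; have gx := gM _ (mem_head _ _).
have [|h' hE] := @lin_exp_gauss _ _ x.1 x.2 g h x0 gx.
  by rewrite -E; apply/mdvd_mulr/mdvd_refl.
apply: IH => // [y yM|]; first by apply: gM; rewrite inE yM orbT.
exists h'; apply: (mulfI (expf_neq0 x.2 (lin_neq0 x0))).
by rewrite E hE mulrCA.
Qed.

(** Presents a power of [Qm M] as a defining polynomial, so that the divisibility lemmas apply to
    it. *)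
Definition scale_mult M e : multiarr K m := [seq (x.1, x.2 * e)%N | x <- M].

Lemma Qm_scale_mult M e : Qm (scale_mult M e) = Qm M ^+ e.
Proof. by rewrite /Qm big_map -prodrXl; apply: eq_bigr => x _; rewrite -exprM. Qed.

Lemma unzip1_scale_mult M e : unzip1 (scale_mult M e) = unzip1 M.
Proof. by rewrite /unzip1 -map_comp. Qed.

Section DetLemmas.
Variables (l : nat).
Implicit Types N : 'M[{mpoly K[m]}]_l.

(** Cramer's rule: [\adj N] times [N a^T] is [\det N] times [a^T], and some entry of [a] is an
    invertible constant. *)
Lemma det_dvd N (a : 'rV[K]_l) g : a != 0 ->
  (forall i, mdvd g (\sum_j (a 0 j)%:MP * N i j)) -> mdvd g (\det N).
Proof.
case/rV0Pn => k ak gN.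
have : (\adj N *m (N *m (map_mx (@mpolyC m K) a)^T)) k 0 = \det N * (a 0 k)%:MP.
  by rewrite mulmxA mul_adj_mx mul_scalar_mx !mxE.
rewrite mxE => E; suff: mdvd g ((a 0 k)^-1%:MP * (\det N * (a 0 k)%:MP)).
  by rewrite mulrCA -mpolyCM mulVf // mulr1.
rewrite -E; apply/mdvd_mull/mdvd_sum => i _; apply/mdvd_mull; rewrite !mxE.
by under eq_bigr => j _ do rewrite !mxE mulrC.
Qed.

(** Expansion along row [k], whose cofactors do not see that row. *)
Lemma det_replace_row N (k : 'I_l) (v : 'I_l -> {mpoly K[m]}) :
  \det (\matrix_(i, j) if i == k then v j else N i j) = \sum_j v j * \adj N j k.
Proof.
rewrite (expand_det_row _ k); apply: eq_bigr => j _; rewrite !mxE eqxx.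
congr (_ * (_ * \det _)); apply/matrixP => i h; rewrite !mxE.
by rewrite eq_sym (negPf (neq_lift _ _)).
Qed.

(* The identity with row [k] replaced; its columns generate the vector
   fields [v] such that [g] divides [a v]. *)
Definition tangent_mx (a : 'rV[K]_l) (k : 'I_l) g : 'M[{mpoly K[m]}]_l :=
  \matrix_(i, j) if i == k then (if j == k then g else - (a 0 j / a 0 k)%:MP)
                 else (1%:M : 'M_l) i j.

Lemma det_tangent_mx (a : 'rV[K]_l) k g : \det (tangent_mx a k g) = g.
Proof.
rewrite det_replace_row adj1 (bigD1 k) //= big1 => [|j /negPf jk].
  by rewrite mxE !eqxx mulr1 addr0.
by rewrite mxE jk mulr0.
Qed.

Lemma mul_tangent_mx (a : 'rV[K]_l) k g j : a 0 k != 0 ->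
  \sum_i (a 0 i)%:MP * tangent_mx a k g i j = (a 0 k)%:MP * g *+ (j == k).
Proof.
move=> ak; rewrite (bigD1 k) //= mxE eqxx.
case: (eqVneq j k) => [->|jk].
  rewrite big1 ?addr0 // => i /negPf ik; rewrite !mxE ik; exact: mulr0.
rewrite (bigD1 j) //= big1 => [|i /andP[/negPf ik /negPf ij]]; last first.
  by rewrite !mxE ik ij mulr0.
rewrite !mxE (negPf jk) eqxx mulr1 addr0 mulrN -mpolyCM mulrC divfK //.
by rewrite addNr.
Qed.

Lemma mulmx_tangent_mx N (a : 'rV[K]_l) k g i j : (N *m tangent_mx a k g) i j =
  if j == k then N i k * g else N i j - N i k * (a 0 j / a 0 k)%:MP.
Proof.
rewrite mxE (bigD1 k) //= mxE eqxx; case: (eqVneq j k) => [->|jk].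
  rewrite big1 ?addr0 // => h /negPf hk; rewrite !mxE hk; exact: mulr0.
rewrite (bigD1 j) //= big1 => [|h /andP[/negPf hk /negPf hj]]; last first.
  by rewrite !mxE hk hj mulr0.
by rewrite !mxE (negPf jk) eqxx mulr1 addr0 mulrN addrC.
Qed.

End DetLemmas.

(** Write the determinant as [Qm M * g]. Expressing suitable elements of [D] in the generators shows
    that [g] divides a power of [Qm M] and is prime to each of its linear factors, hence is
    constant. *)
Lemma saito_det M (th : 'I_m -> der K m) : is_arrangement (unzip1 M) ->
  (forall i, inD M (th i)) ->
  (forall de : der K m, inD M de ->
     exists f : 'I_m -> {mpoly K[m]}, forall j, de j = \sum_(i < m) f i * th i j) ->
  exists2 c : K, c != 0 & \det (\matrix_(i, j) th i j) = c%:MP * Qm M.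
Proof.
move=> arr thD spanD; set T := \matrix_(i, j) _.
have span (N : 'M_m) : (forall i, inD M (N i)) -> exists F : 'M_m, N = F *m T.
  move=> ND; have /fin_all_exists[f fE] : forall i, exists f : 'I_m -> {mpoly K[m]},
    forall j, N i j = \sum_(l < m) f l * th l j by move=> i; apply: spanD.
  exists (\matrix_(i, j) f i j); apply/matrixP => i j; rewrite fE mxE.
  by apply: eq_bigr => l _; rewrite !mxE.
have [g gE] : mdvd (Qm M) (\det T).
  apply: Qm_dvd => // x xM; apply: (@det_dvd _ _ x.1) => [|i].
    by case: arr => _ [M0 _]; apply: M0; apply: map_f.
  by under eq_bigr => j _ do rewrite mxE; apply: thD.
have gQ : mdvd g (Qm M ^+ m).
  (* [Qm M] times each coordinate field is in [D], so [\det T] divides [Qm M ^+ m]. *)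
  have [|F FE] := span (Qm M)%:M.
    move=> i x xM; rewrite /der_app; apply: mdvd_sum => j _; apply: mdvd_mull.
    rewrite mxE; case: eqP => _; last exact: mdvd0.
    by have [p [-> _ _]] := Qm_split arr xM; apply/mdvd_mulr/mdvd_refl.
  rewrite -(det_scalar m) FE det_mulmx gE mulrA mulrC.
  exact/mdvd_mulr/mdvd_refl.
have gM : {in M, forall x, ~ mdvd (lin x.1) g}.
  move=> x xM xg; have x0 : x.1 != 0.
    by case: arr => _ [M0 _]; apply: M0; apply: map_f.
  have [p [QE xp Mp]] := Qm_split arr xM; apply: (xp).
  have [k xk] := rV0Pn _ x0.
  pose h := lin x.1 ^+ x.2.
  (* The columns of the tangent matrix take care of [x] and the factor [p] of all other hyperplanes.
     Comparing determinants, [g] divides [p ^+ m], and [lin x.1] does not. *)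
  have [|F FE] := span (p *: (tangent_mx x.1 k h)^T).
    move=> i y yM; rewrite /der_app.
    under eq_bigr => j _ do rewrite mxE mxE mulrCA.
    rewrite -mulr_sumr; case: (eqVneq y x) => [->|yx].
      apply: mdvd_mull; rewrite mul_tangent_mx //; case: (i == k); last exact: mdvd0.
      exact/mdvd_mull/mdvd_refl.
    by apply: mdvd_mulr; apply: Mp.
  have := congr1 determinant FE.
  rewrite detZ det_tr det_tangent_mx det_mulmx gE QE -/h.
  have -> : \det F * (h * p * g) = (\det F * p * g) * h by ring.
  move/(mulIf (expf_neq0 _ (lin_neq0 x0))) => E.
  by apply: (@lin_prime_exp _ _ _ _ m x0); rewrite E; apply: mdvd_mull.
have [|||c c0 gc] := @dvd_Qm_const (scale_mult M m) g.
- by rewrite unzip1_scale_mult.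
- by move=> y /mapP[x xM ->]; exact: (gM x xM).
- by rewrite Qm_scale_mult.
by exists c => //; rewrite gE gc mulrC.
Qed.

End Multiarrangements.

(** * Homogeneous polynomials and homogeneous components *)

Section Homogeneous.
Variable K : fieldType.

Lemma prod_homog m (I : Type) (s : seq I) (P : pred I) (F : I -> {mpoly K[m]})
    (d : I -> nat) : (forall i, P i -> F i \is (d i).-homog) ->
  \prod_(i <- s | P i) F i \is (\sum_(i <- s | P i) d i)%N.-homog.
Proof.
move=> Fd; elim/big_rec2: _ => [|i e p Pi pe]; first exact: dhomog1.
by apply: dhomogM => //; apply: Fd.
Qed.

Lemma det_homog m l (N : 'M[{mpoly K[m]}]_l) (d : 'I_l -> nat) :
  (forall i j, N i j \is (d i).-homog) -> \det N \is (\sum_i d i)%N.-homog.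
Proof.
by move=> Nd; apply: rpred_sum => s _; rewrite rpredMsign; apply: prod_homog.
Qed.

Lemma adj_homog m l (N : 'M[{mpoly K[m]}]_l) (d : 'I_l -> nat) i j :
  (forall i j, N i j \is (d i).-homog) ->
  \adj N j i \is (\sum_(h | i != h) d h)%N.-homog.
Proof.
move=> Nd; rewrite mxE expand_cofactor; apply: rpred_sum => s _.
by rewrite rpredMsign; apply: prod_homog.
Qed.

(** Split [p] into its components: [f] shifts all their degrees by [e], so only the one of degree
    [d] reaches degree [d + e]. Used for products with a homogeneous factor and for [restrH]. *)
Lemma morph_pihomog m l (f : {mpoly K[m]} -> {mpoly K[l]}) e d p :
  f 0 = 0 -> {morph f : p q / p + q} ->
  (forall d p, p \is d.-homog -> f p \is (d + e)%N.-homog) ->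
  f (pihomog mdeg d p) = pihomog mdeg (d + e) (f p).
Proof.
move=> f0 fD fh; pose k := maxn d.+1 (msize p).
have kp : (msize p <= k)%N by rewrite leq_maxr.
have kd : (d < k)%N by rewrite leq_maxl.
rewrite [in RHS](pihomog_partitionE kp) [in RHS](big_morph f fD f0) raddf_sum /=.
rewrite (bigD1 (Ordinal kd)) //= [X in _ = X + _]pihomog_dE; last exact/fh/pihomogP.
rewrite big1 ?addr0 // => i ni.
by apply: (pihomog_ne0 _ (fh _ _ (pihomogP _ _ _))); rewrite eqn_add2r.
Qed.

Lemma mul_pihomog m e d (p q : {mpoly K[m]}) : q \is e.-homog ->
  q * pihomog mdeg d p = pihomog mdeg (d + e) (q * p).
Proof.
move=> qh; apply: (@morph_pihomog m m (fun p => q * p)); first exact: mulr0.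
  by move=> x y; rewrite mulrDr.
by move=> c r rc; rewrite addnC; apply: dhomogM.
Qed.

Lemma homog_mulKl m e d (p q : {mpoly K[m]}) : q != 0 -> q \is e.-homog ->
  q * p \is (d + e)%N.-homog -> p \is d.-homog.
Proof.
move=> q0 qh pqh; have := mul_pihomog d p qh; rewrite [RHS]pihomog_dE //.
by move/(mulfI q0) <-; apply: pihomogP.
Qed.

Lemma mdvd_pihomog m e d (p q : {mpoly K[m]}) : q \is e.-homog ->
  mdvd q p -> mdvd q (pihomog mdeg (d + e) p).
Proof.
by move=> qh [r ->]; exists (pihomog mdeg d r); rewrite (mul_pihomog _ _ qh).
Qed.

Lemma homog_msize m d (p : {mpoly K[m]}) : p != 0 -> p \is d.-homog -> msize p = d.+1.
Proof.
move=> p0 ph; have := dhomog_uniq p0 ph (dhomog_msize ph).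
by move: p0; rewrite -msize_poly_eq0; move: (msize p) => u; lia.
Qed.

Lemma homog_mul_const m d (p q : {mpoly K[m]}) : p * q != 0 -> p \is d.-homog ->
  p * q \is d.-homog -> exists2 c : K, c != 0 & q = c%:MP.
Proof.
rewrite mulf_eq0 negb_or => /andP[p0 q0] ph pqh; apply/msize_poly1P.
have := msizeM p0 q0; rewrite (homog_msize (mulf_neq0 p0 q0) pqh) (homog_msize p0 ph).
by move: (msize q) => u; lia.
Qed.

End Homogeneous.

(** * Restriction of polynomials to the coordinate hyperplane *)

Section Restriction.
Variables (K : fieldType) (n : nat).
Local Notation restrH := (@restrH K n).

Let restr_tuple : n.+1.-tuple {mpoly K[n]} :=
  [tuple (if unlift ord0 i is Some j then 'X_j else 0) | i < n.+1].

HB.instance Definition _ := GRing.RMorphism.copy restrH (comp_mpoly restr_tuple).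

Lemma restrH_lin (a : 'rV[K]_n.+1) : restrH (lin a) = lin (restr_form a).
Proof.
rewrite /lin rmorph_sum big_ord_recl /= /Defs.restrH.
rewrite comp_mpolyZ comp_mpolyXU -tnth_nth tnth_mktuple unlift_none scaler0 add0r.
apply: eq_bigr => i _.
by rewrite comp_mpolyZ comp_mpolyXU -tnth_nth tnth_mktuple liftK mxE.
Qed.

Lemma restrH_homog d p : p \is d.-homog -> restrH p \is d.-homog.
Proof.
move=> /dhomogP ph; rewrite /Defs.restrH comp_mpolyE big_seq.
apply: rpred_sum => u /ph <-; apply: rpredZ => /=; rewrite mdegE.
apply: prod_homog => i _; rewrite -[X in X.-homog]mul1n; apply: dhomogMn.
rewrite tnth_mktuple; case: unliftP => [j _|_]; last exact: rpred0.
by rewrite dhomogX /= mdeg1.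
Qed.

Lemma restrH_pihomog d p : restrH (pihomog mdeg d p) = pihomog mdeg d (restrH p).
Proof.
rewrite -[d in RHS]addn0; apply: morph_pihomog; first exact: rmorph0.
  exact: rmorphD.
by move=> e q qe; rewrite addn0; apply: restrH_homog.
Qed.

End Restriction.

(** * Grouping linear forms by proportionality *)

Section Classes.
Variables (K : fieldType) (m : nat).
Implicit Types (a b : 'rV[K]_m) (s : seq 'rV[K]_m).

Lemma classes_sub s : {subset classes s <= s}.
Proof.
elim: s => //= b s IH a; case: ifP => _; first by move/IH; rewrite inE orbC => ->.
by rewrite !inE => /orP[->//|/IH->]; rewrite orbT.
Qed.

Lemma classes_cover s a : a \in s -> has (propf a) (classes s).
Proof.
elim: s a => //= b s IH a; rewrite inE => /orP[/eqP->|/IH].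
  by case: ifP => //= _; rewrite propf_refl.
by case: ifP => //= _ ->; rewrite orbT.
Qed.

Lemma classes_arrangement s : {in s, forall a, a != 0} -> is_arrangement (classes s).
Proof.
move=> s0; split; last split; last 1 first.
- elim: s {s0} => //= b s IH a c; case: ifPn => [_|/hasPn Nb]; first exact: IH.
  rewrite !inE => /orP[/eqP->|ar] /orP[/eqP->|cr] //; first by rewrite eqxx.
  + by move=> _; apply: Nb.
  + by move=> _; rewrite propf_sym; apply: Nb.
  + exact: IH.
- elim: s {s0} => //= b s IH; case: ifPn => [//|/hasPn Nb] /=; rewrite IH andbT.
  by apply/negP => /Nb; rewrite propf_refl.
- by move=> a /classes_sub/s0.
Qed.

(** Every form is a constant times the representative of its class; [c] collects these constants. *)
Lemma prod_classes s : {in s, forall a, a != 0} ->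
  exists2 c : K, c != 0 &
    \prod_(a <- s) lin a = c%:MP * \prod_(b <- classes s) lin b ^+ count (propf b) s.
Proof.
elim: s => [_|b s IH s0]; first by exists 1; rewrite ?oner_neq0 // !big_nil mulr1.
have s0' : {in s, forall a, a != 0} by move=> a ins; rewrite s0 // inE ins orbT.
have b0 : b != 0 by rewrite s0 ?mem_head.
have [c c0 sE] := IH s0'; have [ur [_ sd]] := classes_arrangement s0'.
rewrite big_cons sE /=; case: ifPn => [/hasP[x xr bx]|/hasPn Nb].
  have -> : \prod_(y <- classes s) lin y ^+ (propf y b + count (propf y) s)
      = \prod_(y <- classes s) lin y ^+ propf y b
        * \prod_(y <- classes s) lin y ^+ count (propf y) s.
    by rewrite -big_split; apply: eq_bigr => y _; rewrite exprD.
  (* As an exponent, [propf y b] is 1 for the single representative [x] of the class of [b] and 0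
     for all others. *)
  have -> : \prod_(y <- classes s) lin y ^+ propf y b = lin x.
    rewrite (bigD1_seq x) //= propf_sym bx big_seq_cond big1 ?mulr1 // => y.
    case/andP => yr yx; suff /negPf-> : ~~ propf y b by [].
    by apply: contra (sd _ _ yr xr yx) => yb; apply: propf_trans bx.
  have [e e0 ->] := propfP _ b0 bx.
  exists (c / e); first by rewrite mulf_neq0 ?invr_neq0.
  rewrite linZ -mul_mpolyC mpolyCM.
  set u := \prod_(_ <- _) _.
  have -> : c%:MP * e^-1%:MP * (e%:MP * lin b * u)
    = (e^-1%:MP * e%:MP) * (c%:MP * lin b * u) :> {mpoly K[m]} by ring.
  by rewrite -mpolyCM mulVf // mul1r; ring.
exists c => //; rewrite big_cons propf_refl.
(* A form of [s] proportional to [b] would make its representative proportional to [b]; so [b] opens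
   a class of multiplicity one. *)
have -> : count (propf b) s = 0%N.
  apply/eqP; rewrite -leqn0 leqNgt -has_count; apply/hasPn => a ins.
  have /hasP[x xr ax] := classes_cover ins.
  by apply: contra (Nb _ xr) => ba; apply: propf_trans ax.
rewrite mulrCA expr1; congr (_ * (_ * _)).
rewrite [LHS]big_seq [RHS]big_seq; apply: eq_bigr => y yr.
by rewrite propf_sym (negPf (Nb _ yr)).
Qed.

End Classes.

(** * Logarithmic forms, dual to logarithmic vector fields *)

Section Duality.
Variable K : fieldType.

(** The expression to be divided is the determinant of [T] with row [s] replaced by [v], a vector
    that [a] annihilates. The other rows are in [D], so [det_dvd] applies. *)
Lemma adj_inOmega1 m (M : multiarr K m) (th : 'I_m -> der K m) s :
  is_arrangement (unzip1 M) -> (forall i, inD M (th i)) ->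
  inOmega1 M (fun j => \adj (\matrix_(i, j) th i j) j s).
Proof.
move=> [_ [M0 _]] thD x xM i j; set T := \matrix_(i, j) _.
pose v l : {mpoly K[m]} := (x.1 0 i)%:MP *+ (l == j) - (x.1 0 j)%:MP *+ (l == i).
have vE (F : 'I_m -> {mpoly K[m]}) :
    \sum_l v l * F l = (x.1 0 i)%:MP * F j - (x.1 0 j)%:MP * F i.
  have dE (c : {mpoly K[m]}) k : \sum_l c *+ (l == k) * F l = c * F k.
    rewrite (bigD1 k) //= eqxx big1 ?addr0 // => l /negPf ->; exact: mul0r.
  by under eq_bigr => l _ do rewrite mulrBl; rewrite sumrB !dE.
rewrite -[X in mdvd _ X](vE (fun l => \adj T l s)) -det_replace_row.
apply: (@det_dvd _ _ _ _ x.1).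
  by apply: M0; apply: map_f.
move=> h; under eq_bigr => l _ do rewrite mxE.
case: eqP => _; last first.
  by under eq_bigr => l _ do rewrite mxE; apply: thD.
under eq_bigr => l _ do rewrite mulrC.
by rewrite vE mulrC subrr; apply: mdvd0.
Qed.

Lemma mdvd_matrix m k l g (N : 'M[{mpoly K[m]}]_(k, l)) :
  (forall i j, mdvd g (N i j)) -> exists N', N = g *: N'.
Proof.
move=> gN; have /fin_all_exists[F FE] : forall i, exists f : 'I_l -> {mpoly K[m]},
    forall j, N i j = g * f j.
  move=> i; have /fin_all_exists[f fE] : forall j, exists r, N i j = g * r := gN i.
  by exists f.
by exists (\matrix_(i, j) F i j); apply/matrixP => i j; rewrite !mxE.
Qed.

Lemma scalemxE (R : pzRingType) k l (g : R) (N : 'M_(k, l)) i j :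
  (g *: N) i j = g * N i j.
Proof. exact: mxE. Qed.

(** Multiply the hypothesis by [\adj P] on the left and by [\adj P'] on the right. *)
Lemma adj_of_mulmx (R : comNzRingType) l (P B P' : 'M[R]_l) (g : R) :
  P *m B = g *: P' -> \det P *: (B *m \adj P') = (g * \det P') *: \adj P.
Proof.
move=> PB; rewrite -mul_scalar_mx -mul_adj_mx -mulmxA (mulmxA P) PB.
by rewrite -scalemxAl mul_mx_adj scale_scalar_mx mul_mx_scalar.
Qed.

Section LogarithmicMatrix.
Variables (n : nat) (P : 'M[{mpoly K[n.+1]}]_n.+1).
Implicit Type a : 'rV[K]_n.+1.
Hypothesis P0 : \det P != 0.

(** The logarithmic condition for a simple pole: modulo [lin a], each row of [P] is a multiple of
    [a]. *)
Let tangent a :=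
  forall s i j, mdvd (lin a) ((a 0 i)%:MP * P s j - (a 0 j)%:MP * P s i).

(** Modulo [lin a], the rows of [P] are multiples of [a], which annihilates every column of the
    tangent matrix but column [k]; that one carries the factor [lin a]. *)
Lemma mul_tangent_logarithmic a k : a 0 k != 0 -> tangent a ->
  exists P', P *m tangent_mx a k (lin a) = lin a *: P'.
Proof.
move=> ak aP; apply: mdvd_matrix => i j; rewrite mulmx_tangent_mx.
case: eqP => _; first exact/mdvd_mull/mdvd_refl.
have := mdvd_mull (a 0 k)^-1%:MP (aP i k j); rewrite mulrBr !mulrA -!mpolyCM.
by rewrite mulVf // mul1r [_ * P i k]mulrC [_^-1 * _]mulrC.
Qed.

(** All three come from [P *m B = lin a *: P'] with [\det B = lin a]: determinants give the first,
    adjugates give [lin a *: \adj P = lin a ^+ n *: (B *m \adj P')], and pairing with [a] gains one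
    more factor since [lin a] divides [a B]. *)
Lemma logarithmic_dvd a : a != 0 -> tangent a ->
  [/\ mdvd (lin a ^+ n) (\det P),
      forall i s, mdvd (lin a ^+ n) (lin a * \adj P i s)
    & forall s, mdvd (lin a ^+ n.+1) (lin a * \sum_i (a 0 i)%:MP * \adj P i s)].
Proof.
move=> a0 aP; have l0 := lin_neq0 a0; have [k ak] := rV0Pn _ a0.
have [P' PE] := mul_tangent_logarithmic ak aP.
set B := tangent_mx _ _ _ in PE.
have dE : \det P = lin a ^+ n * \det P'.
  apply: (mulIf l0); have := congr1 determinant PE.
  by rewrite det_mulmx det_tangent_mx detZ exprS => ->; ring.
have d0 : \det P' != 0 by move: P0; rewrite dE mulf_eq0 negb_or => /andP[].
have adjE : lin a *: \adj P = lin a ^+ n *: (B *m \adj P').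
  apply/matrixP => i j; apply: (mulfI d0).
  have /matrixP/(_ i j) := adj_of_mulmx PE.
  by rewrite dE !scalemxE !(mulrCA (\det P')) !mulrA => ->.
split=> [|i s|s]; first by exists (\det P').
  have /matrixP/(_ i s) := adjE; rewrite !scalemxE => ->.
  exact/mdvd_mulr/mdvd_refl.
rewrite mulr_sumr.
have -> : \sum_i lin a * ((a 0 i)%:MP * \adj P i s)
        = \sum_i lin a ^+ n * ((a 0 i)%:MP * (B *m \adj P') i s).
  apply: eq_bigr => i _; rewrite !(mulrCA _ (a 0 i)%:MP); congr (_ * _).
  by have /matrixP/(_ i s) := adjE; rewrite !scalemxE.
rewrite -mulr_sumr.
under eq_bigr => i _ do rewrite mxE mulr_sumr.
rewrite exchange_big exprSr /=; have [r E] : mdvd (lin a)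
    (\sum_j \sum_i (a 0 i)%:MP * (B i j * \adj P' j s)).
  apply: mdvd_sum => j _; under eq_bigr => i _ do rewrite mulrA.
  rewrite -mulr_suml mul_tangent_mx //; apply: mdvd_mulr.
  by case: (j == k); [apply/mdvd_mull/mdvd_refl|apply: mdvd0].
by exists r; rewrite E mulrA.
Qed.

End LogarithmicMatrix.

Lemma simple_arrangement m (A : seq 'rV[K]_m) : unzip1 (simple A) = A.
Proof. by rewrite /unzip1 /simple -map_comp map_id_in. Qed.

Lemma Qm_simple m (A : seq 'rV[K]_m) : Qm (simple A) = \prod_(a <- A) lin a.
Proof. by rewrite /Qm big_map. Qed.

Lemma prod_lin_homog m (s : seq 'rV[K]_m) : \prod_(a <- s) lin a \is (size s).-homog.
Proof. by rewrite -sum1_size; apply: prod_homog => a _; apply: lin_homog. Qed.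

(** Saito's criterion for the forms [P s / Q]: the degree condition forces [\det P] to be a constant
    times [Q ^+ n], and the dual basis, rescaled by that constant, is a basis of [D]. *)
Lemma saito_forms n (A : seq 'rV[K]_n.+1) (P : 'M[{mpoly K[n.+1]}]_n.+1)
    (e d : 'I_n.+1 -> nat) :
  is_arrangement A -> (forall s, inOmega1 (simple A) (P s)) ->
  (forall s j, P s j \is (e s).-homog) -> \det P != 0 ->
  (\sum_s e s = n * size A)%N -> (forall s, e s + d s = size A)%N ->
  free_with_exponents (simple A) d.
Proof.
move=> arr PO Ph P0 eE ed; set Q := Qm (simple A).
have arrS : is_arrangement (unzip1 (simple A)) by rewrite simple_arrangement.
have Q0 : Q != 0 by apply: Qm_neq0.
have Qh : Q \is (size A).-homog by rewrite /Q Qm_simple prod_lin_homog.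
have Qnh : Q ^+ n \is (n * size A)%N.-homog by rewrite mulnC; apply: dhomogMn.
have Qn0 : Q ^+ n != 0 by rewrite expf_neq0.
have aS a : a \in A -> (a, 1%N) \in simple A by move=> aA; apply: map_f.
have A0 a : a \in A -> a != 0 by case: arr => _ [A0 _]; apply: A0.
have tgP a : a \in A -> forall s i j,
    mdvd (lin a) ((a 0 i)%:MP * P s j - (a 0 j)%:MP * P s i).
  by move=> aA s i j; have := PO s _ (aS _ aA) i j; rewrite /= expr1.
have Qn_dvd p : (forall a, a \in A -> mdvd (lin a ^+ n) p) -> mdvd (Q ^+ n) p.
  move=> pA; rewrite -Qm_scale_mult; apply: Qm_dvd; first by rewrite unzip1_scale_mult.
  by move=> y /mapP[x /mapP[a aA ->] ->] /=; rewrite mul1n; apply: pA.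
have splitQ a : a \in A -> exists2 q, Q = lin a * q & ~ mdvd (lin a) q.
  move=> /aS aM; have [q [qE aq _]] := Qm_split arrS aM.
  by exists q; rewrite // -[lin a]expr1.
(* [Q ^+ n] divides [\det P] and both have degree [n * size A]. *)
have [c c0 dP] : exists2 c : K, c != 0 & \det P = Q ^+ n * c%:MP.
  have [|q qE] := Qn_dvd (\det P).
    by move=> a aA; have [] := logarithmic_dvd P0 (A0 _ aA) (tgP _ aA).
  have [||c c0 qc] := @homog_mul_const _ _ _ (Q ^+ n) q _ Qnh.
  - by rewrite -qE.
  - by rewrite -qE -eE; apply: det_homog.
  by exists c; rewrite // qE qc.
(* Up to the factor [c], [Th] is the inverse of the matrix [P / Q] of forms; its columns are the
   basis. *)
have [Th ThE] : exists Th, Q *: \adj P = Q ^+ n *: Th.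
  apply: mdvd_matrix => i s; apply: Qn_dvd => a aA; rewrite mxE.
  have [q -> _] := splitQ a aA; rewrite mulrAC; apply: mdvd_mulr.
  by have [_ + _] := logarithmic_dvd P0 (A0 _ aA) (tgP _ aA); apply.
have cancelQn (N N' : 'M_n.+1) : Q ^+ n *: N = Q ^+ n *: N' -> N = N'.
  move/matrixP => E; apply/matrixP => i j; apply: (mulfI Qn0).
  by have := E i j; rewrite !scalemxE.
have PTh : P *m Th = (Q * c%:MP)%:M.
  apply: cancelQn; rewrite scalemxAr -ThE -scalemxAr mul_mx_adj dP.
  by rewrite !scale_scalar_mx mulrCA.
have ThP : Th *m P = (Q * c%:MP)%:M.
  apply: cancelQn; rewrite scalemxAl -ThE -scalemxAl mul_adj_mx dP.
  by rewrite !scale_scalar_mx mulrCA.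
exists (fun s j => Th j s); split; last split; last split.
- move=> s x /mapP[a aA ->] /=; have [q QE aq] := splitQ a aA.
  have an0 : lin a ^+ n != 0 by rewrite expf_neq0 ?lin_neq0 ?A0.
  have [_ _ /(_ s) dv] := logarithmic_dvd P0 (A0 _ aA) (tgP _ aA).
  (* With [Q = lin a * q] and [q] prime to [lin a], it is enough that [lin a ^+ n.+1] divides
     [Q ^+ n] times the value of the field on [a]. *)
  apply: (@lin_exp_gauss_iter _ _ a 1 n q) => //; first exact: A0.
  apply: (mdvd_mul2l an0); rewrite -exprD addn1 mulrA -exprMn -QE /der_app.
  have -> : Q ^+ n * (\sum_(j < n.+1) (a 0 j)%:MP * Th j s)
          = q * (lin a * \sum_(j < n.+1) (a 0 j)%:MP * \adj P j s).
    rewrite mulrA [q * _]mulrC -QE !mulr_sumr; apply: eq_bigr => j _.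
    have /matrixP/(_ j s) := ThE; rewrite !scalemxE => E.
    by rewrite mulrCA -E mulrCA.
  exact: mdvd_mull.
- move=> s j; apply: (homog_mulKl Qn0 Qnh).
  have /matrixP/(_ j s) := ThE; rewrite !scalemxE => <-.
  have := dhomogM Qh (adj_homog s j Ph).
  have := eE; rewrite (bigD1 s) //= => eE'; have := ed s.
  have -> : (\sum_(h | s != h) e h = \sum_(h < n.+1 | h != s) e h)%N.
    by apply: eq_bigl => h; rewrite eq_sym.
  move=> ds.
  (* Both sides are the degree of [Q * \adj P j s], which equals [Q ^+ n * Th j s]. *)
  suff -> : (size A + \sum_(h < n.+1 | h != s) e h = d s + n * size A)%N by [].
  by move: eE' ds; move: (\sum_(h < _ | _) _)%N (n * _)%N => u v; lia.
- move=> de deD; pose v := \col_j de j.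
  (* Logarithmic forms pair with logarithmic fields to polynomials. These values [w], divided by
     [c], are the coordinates of [de], because [Th *m P] is the scalar [Q * c]. *)
  have [w wE] : exists w, P *m v = Q *: w.
    apply: mdvd_matrix => s j; apply: Qm_dvd => // x /mapP[a aA ->] /=.
    have [k ak] := rV0Pn _ (A0 _ aA); rewrite expr1 mxE.
    suff: mdvd (lin a) ((a 0 k)%:MP * \sum_l P s l * v l j).
      move/(mdvd_mull (a 0 k)^-1%:MP); rewrite mulrA -mpolyCM mulVf //.
      by rewrite mul1r.
    have -> : (a 0 k)%:MP * (\sum_l P s l * v l j) =
        \sum_l ((a 0 k)%:MP * P s l - (a 0 l)%:MP * P s k) * de l
        + P s k * der_app de a.
      rewrite !mulr_sumr -big_split; apply: eq_bigr => l _ /=; rewrite mxE; ring.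
    apply: mdvdD; first by apply: mdvd_sum => l _; apply/mdvd_mulr/tgP.
    by apply: mdvd_mull; have := deD _ (aS _ aA); rewrite /= expr1.
  exists (fun i => c^-1%:MP * w i 0) => j; apply: (mulfI Q0).
  have := congr1 (fun u => (Th *m u) j 0) wE.
  rewrite mulmxA ThP mul_scalar_mx -scalemxAr !scalemxE => E.
  rewrite -[LHS]mul1r -mpolyC1 -(mulVf c0) mpolyCM.
  transitivity (c^-1%:MP * (Q * c%:MP * v j 0)); first by rewrite mxE; ring.
  rewrite E mxE mulrCA; congr (_ * _); rewrite mulr_sumr.
  by apply: eq_bigr => i _; ring.
(* Multiplying the relation by [P] turns it into [Q * c * f i = 0]. *)
- move=> f fTh i; have : (P *m (Th *m \col_i f i)) i 0 = 0.
    suff -> : Th *m \col_i f i = 0 by rewrite mulmx0 mxE.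
    apply/matrixP => j j'; rewrite !mxE -[RHS](fTh j).
    by apply: eq_bigr => l _; rewrite mxE mulrC.
  rewrite mulmxA PTh mul_scalar_mx !mxE => /eqP.
  by rewrite !mulf_eq0 (negPf Q0) mpolyC_eq0 (negPf c0) => /eqP.
Qed.

End Duality.

(** * The multirestriction to [H] and the restriction of forms *)

Section MultiRestriction.
Variables (K : fieldType) (n : nat) (A : seq 'rV[K]_n.+1) (aH : 'rV[K]_n.+1) (c : K).
Hypotheses (arr : is_arrangement A) (HA : aH \in A).
Hypotheses (c0 : c != 0) (aHE : aH = c *: delta_mx 0 ord0).

Let R := [seq restr_form a | a <- A & a != aH].
Let Qdel : {mpoly K[n.+1]} := \prod_(a <- A | a != aH) lin a.

(** A form that vanishes on [H] is proportional to [aH], against the distinctness of the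
    hyperplanes. *)
Lemma restr_form_neq0 a : a \in A -> a != aH -> restr_form a != 0.
Proof.
case: arr => _ [A0 Ad] aA aaH.
apply: contraNneq (Ad _ _ HA aA _); last by rewrite eq_sym.
move=> r0; have aE : a = (a 0 ord0 / c) *: aH.
  apply/rowP => i; rewrite aHE !mxE; case: (unliftP ord0 i) => [j ->|->].
    by have /rowP/(_ j) := r0; rewrite !mxE => ->; rewrite eq_sym eq_liftF /= !mulr0.
  by rewrite !eqxx mulr1 divfK.
apply/propfP; first exact: A0.
exists (a 0 ord0 / c) => //; apply: contraTneq (A0 _ aA) => e0.
by rewrite aE e0 scale0r eqxx.
Qed.

Lemma restr_multi_arrangement : is_arrangement (unzip1 (restr_multi A aH)).
Proof.
rewrite /unzip1 -map_comp map_id; apply: classes_arrangement.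
by move=> b /mapP[a]; rewrite mem_filter => /andP[aaH aA] ->; apply: restr_form_neq0.
Qed.

Lemma Qm_simple_restr : Qm (simple A) = lin aH * Qdel.
Proof. by rewrite Qm_simple (bigD1_seq aH) //; case: arr. Qed.

Lemma restrH_Qdel :
  exists2 e : K, e != 0 & restrH Qdel = e%:MP * Qm (restr_multi A aH).
Proof.
have [|e e0 E] := @prod_classes _ _ R.
  by move=> b /mapP[a]; rewrite mem_filter => /andP[aaH aA] ->; apply: restr_form_neq0.
exists e => //; rewrite /Qm big_map -E big_map big_filter rmorph_prod.
by apply: eq_bigr => a _; apply: restrH_lin.
Qed.

Lemma Qdel_homog : Qdel \is (size R).-homog.
Proof. by rewrite /Qdel -big_filter size_map; apply: prod_lin_homog. Qed.

Lemma size_restr : size A = (size R).+1.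
Proof.
rewrite size_map size_filter -(count_predC (pred1 aH)) count_uniq_mem ?HA //.
by case: arr.
Qed.

Lemma restrH_Qdel_homog : restrH Qdel \is (size R).-homog.
Proof. exact/restrH_homog/Qdel_homog. Qed.

(** This is the numerator of [d x_0 / x_0] up to the constant [c], since [lin aH] is [c] times
    [x_0]. *)
Lemma dlog_inOmega1 :
  inOmega1 (simple A) (fun j => if j == ord0 then Qdel else 0).
Proof.
move=> x /mapP[a aA ->] i j /=; rewrite expr1.
case: (eqVneq a aH) => [->|aaH]; last first.
  suff dv : mdvd (lin a) Qdel.
    by apply/mdvdD; last apply/mdvdN; apply: mdvd_mull; case: eqP => // _; apply: mdvd0.
  rewrite /Qdel -big_filter (big_rem a) /= ?mem_filter ?aaH //.
  exact/mdvd_mulr/mdvd_refl.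
have aHj h : h != ord0 -> aH 0 h = 0 by move=> /negPf h0; rewrite aHE !mxE h0 mulr0.
case: (eqVneq j ord0) => [->|j0]; case: (eqVneq i ord0) => [->|i0].
- by rewrite subrr; apply: mdvd0.
- by rewrite aHj // mpolyC0 mul0r mulr0 subrr; apply: mdvd0.
- by rewrite (aHj j) // mpolyC0 mul0r mulr0 subrr; apply: mdvd0.
- by rewrite !mulr0 subrr; apply: mdvd0.
Qed.

(* Away from [d x_0] a logarithmic form has no pole along [H], so its
   restriction can be computed on numerators. *)
Lemma res1_numerator (e : K) p r : restrH Qdel = e%:MP * Qm (restr_multi A aH) ->
  inOmega1 (simple A) p -> res1_eq A aH p r ->
  exists p' : 'I_n -> {mpoly K[n.+1]}, forall i,
    p (lift ord0 i) = lin aH * p' i /\ restrH (p' i) = e%:MP * r i.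
Proof.
move=> QE pO pr; suff H i : exists q, p (lift ord0 i) = lin aH * q /\
    restrH q = e%:MP * r i by have /fin_all_exists[p' p'E] := H; exists p'.
have aH0 : aH != 0 by case: arr => _ [A0 _]; apply: A0.
have [p' pE] : mdvd (lin aH) (p (lift ord0 i)).
  have aS : (aH, 1%N) \in simple A by apply: map_f.
  (* For the indices 0 and [lift ord0 i] the condition along [H] reduces to divisibility of [c]
     times this coefficient. *)
  have := mdvd_mull c^-1%:MP (pO _ aS ord0 (lift ord0 i)); rewrite /= expr1.
  by rewrite aHE !mxE /= mulr1 mulr0 mpolyC0 mul0r subr0 mulrA -mpolyCM mulVf // mul1r.
exists p'; split=> //; have [u [v [v0 [puv uv]]]] := pr i.
have {}puv : p' * v = Qdel * u.
  apply: (mulfI (lin_neq0 aH0)).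
  by rewrite mulrA -pE puv Qm_simple_restr mulrA.
(* Restrict [p' * v = Qdel * u] to [H] and cancel the nonzero restriction of [v]. *)
apply: (mulIf v0); rewrite -[RHS]mulrA -uv -rmorphM puv rmorphM /= QE; ring.
Qed.

End MultiRestriction.

(** * Freeness of the arrangement from that of its multirestriction *)

Theorem mainTheorem1 (K : fieldType) (n : nat)
    (A : seq 'rV[K]_n.+1) (aH : 'rV[K]_n.+1) (d' : 'I_n -> nat) :
  [pchar K] =i pred0 ->
  is_arrangement A ->
  aH \in A ->
  (exists c : K, c != 0 /\ aH = c *: delta_mx 0 ord0) ->
  res1_surjective A aH ->
  free_with_exponents (restr_multi A aH) d' ->
  free_with_exponents (simple A) (cons_exp d').
Proof.
move=> _ arr HA [c [c0 aHE]] surj [th [thD [thh [span _]]]].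
have arrH := restr_multi_arrangement arr HA c0 aHE.
pose N := size [seq restr_form a | a <- A & a != aH].
pose Qdel : {mpoly K[n.+1]} := \prod_(a <- A | a != aH) lin a.
have sA : size A = N.+1 := size_restr arr HA.
have [e e0 QE] := restrH_Qdel arr HA c0 aHE.
have [k k0 dT] := saito_det arrH thD span.
set T := \matrix_(i, j) _ in dT.
have QH0 := Qm_neq0 arrH.
have T0 : \det T != 0 by rewrite dT mulf_neq0 ?mpolyC_eq0.
(* Compare degrees: [\det T] is a nonzero constant times the restriction of [Qdel]. *)
have NE : (\sum_s d' s)%N = N.
  have Th : \det T \is (\sum_s d' s)%N.-homog by apply: det_homog => i j; rewrite mxE.
  have QH := restrH_Qdel_homog A aH; rewrite QE in QH.
  apply: (dhomog_uniq T0 Th).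
  have -> : \det T = (k / e) *: (e%:MP * Qm (restr_multi A aH)).
    by rewrite -mul_mpolyC mulrA -mpolyCM divfK.
  exact: rpredZ.
(* The degree of column [s] of [\adj T]; over a denominator of degree [N], the form has degree
   [- d' s]. *)
pose D s := (\sum_(h | s != h) d' h)%N.
have DE s : (D s + d' s)%N = N.
  rewrite -NE (bigD1 s) //= addnC; congr (_ + _)%N.
  by apply: eq_bigl => h; rewrite eq_sym.
have rO s := adj_inOmega1 s arrH thD.
have rh s j : \adj T j s \is (D s).-homog by apply: adj_homog => i h; rewrite mxE.
have /fin_all_exists2[p pO pr] : forall s, exists2 p, inOmega1 (simple A) p &
    res1_eq A aH p (fun j => \adj T j s).
  by move=> s; have [p []] := surj _ (rO s); exists p.
have /fin_all_exists[p' p'E] := fun s => res1_numerator arr HA c0 aHE QE (pO s) (pr s).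
(* Numerator degrees over [Q(A)], whose degree [N + 1] exceeds that of the denominator on [H] by
   one. *)
pose E i := (if unlift ord0 i is Some s then D s + 1 else N)%N.
(* Lifts need not be homogeneous, so only the component of the expected degree is kept. *)
pose P : 'M[{mpoly K[n.+1]}]_n.+1 := \matrix_(i, j)
  if unlift ord0 i is Some s then pihomog mdeg (D s + 1) (p s j)
  else if j == ord0 then Qdel else 0.
have P0j j : P ord0 j = if j == ord0 then Qdel else 0 by rewrite mxE unlift_none.
have PS s j : P (lift ord0 s) j = pihomog mdeg (D s + 1) (p s j) by rewrite mxE liftK.
have PSl s i : P (lift ord0 s) (lift ord0 i) = lin aH * pihomog mdeg (D s) (p' s i).
  by rewrite PS (p'E s i).1 (mul_pihomog _ _ (lin_homog aH)).
apply: (@saito_forms _ _ _ P E) => //.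
- move=> s x xA i j; case: (unliftP ord0 s) => [t ->|->]; last first.
    by rewrite !P0j; apply: (dlog_inOmega1 aHE xA).
  (* Taking components is linear and compatible with multiples of [lin a], so the logarithmic
     condition survives. *)
  rewrite !PS !mul_mpolyC -!linearZ -linearB /= -!mul_mpolyC.
  have := pO t _ xA i j; case/mapP: xA => a aA -> /=.
  by rewrite expr1; apply: mdvd_pihomog; apply: lin_homog.
- move=> s j; rewrite /E; case: (unliftP ord0 s) => [t ->|->].
    by rewrite PS; apply: pihomogP.
  by rewrite P0j; case: eqP => _; [apply: Qdel_homog|apply: rpred0].
(* Expand along the row of [d x_0 / x_0]; each of the [n] remaining rows yields a factor
   [lin aH]. *)
- have -> : \det P =
      Qdel * (lin aH ^+ n * \det (\matrix_(s, i) pihomog mdeg (D s) (p' s i))).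
    rewrite (expand_det_row _ ord0) big_ord_recl P0j eqxx big1 => [|i _].
      rewrite addr0 /cofactor /= expr0 mul1r -detZ; congr (_ * \det _).
      by apply/matrixP => s i; rewrite !mxE -PSl mxE.
    by rewrite P0j mul0r.
  have aH0 : aH != 0 by case: arr => _ [A0 _]; apply: A0.
  rewrite !mulf_neq0 ?expf_neq0 ?lin_neq0 //.
    apply: contraNneq QH0 => Q0; have := QE; rewrite -/Qdel Q0 rmorph0 => /esym/eqP.
    by rewrite mulf_eq0 mpolyC_eq0 (negPf e0).
  (* Nonvanishing is tested on [H], where the matrix becomes [e] times the transposed adjugate of
     [T]. *)
  suff : restrH (\det (\matrix_(s, i) pihomog mdeg (D s) (p' s i))) != 0.
    by apply: contra_neq => ->; apply: rmorph0.
  rewrite -det_map_mx.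
  have -> : map_mx (@restrH K n) (\matrix_(s, i) pihomog mdeg (D s) (p' s i))
      = e%:MP *: (\adj T)^T.
    apply/matrixP => s i; rewrite 2!mxE scalemxE mxE restrH_pihomog (p'E s i).2.
    by rewrite pihomog_dE // mul_mpolyC; apply/rpredZ/rh.
  rewrite detZ det_tr mulf_neq0 ?expf_neq0 ?mpolyC_eq0 //.
  have := congr1 determinant (mul_mx_adj T); rewrite det_mulmx det_scalar.
  by move=> dE; have := expf_neq0 n T0; rewrite -dE mulf_eq0 negb_or => /andP[].
(* The sum is [N + (n * N - N) + n], that is [n * (N + 1)]. *)
- rewrite big_ord_recl /E unlift_none sA.
  under eq_bigr => s _ do rewrite liftK.
  have : (\sum_s (D s + d' s) = n * N)%N.
    under eq_bigr => s _ do rewrite DE.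
    by rewrite sum_nat_const card_ord.
  rewrite !big_split NE sum_nat_const card_ord /=; lia.
- move=> s; rewrite /E /cons_exp sA; case: (unlift ord0 s) => [t|]; last lia.
  by have := DE t; lia.
Qed.
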